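(* Suppose that the sequences $a_k$ and $b_k$ are nondecreasing. Then for $k=0,1,\dots$, $$S_2(\mathbf{p}_k)=\mathbf{p}_k^2(x)-\frac{a_{k+1}}{a_k}\,\mathbf{p}_{k-1}(x)\mathbf{p}_{k+1}(x)\ge0\qquad\text{for all } x\ge b_k-2a_k.$$
   Context: $\mathbf{p}_k$ are the orthonormal polynomials defined by $\mathbf{p}_{-1}=0$, $\mathbf{p}_0=1$ and $$a_k\mathbf{p}_k=(x-b_{k-1})\mathbf{p}_{k-1}-a_{k-1}\mathbf{p}_{k-2},\qquad k\ge1,$$ where $b_k\in\mathbb{R}$, $a_k>0$ for $k\ge1$, and $a_0=0$. For $k=0$, since $\mathbf{p}_{-1}=0$, one reads $S_2(\mathbf{p}_0)=\mathbf{p}_0^2=1$. *)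

(* Defs.v *)
From mathcomp Require Import all_boot all_order all_algebra.
From mathcomp Require Import reals.

Set Implicit Arguments.
Unset Strict Implicit.
Unset Printing Implicit Defensive.

Import Order.TTheory GRing.Theory Num.Theory.

Local Open Scope ring_scope.

Section OrthonormalPolynomials.
Variable R : realType.
Implicit Types a b : nat -> R.

(* Index shifted by one: [orthopoly_shift a b k.+1] is p_k, and
   [orthopoly_shift a b 0] is p_{-1}. *)
Fixpoint orthopoly_shift a b (n : nat) : {poly R} :=
  match n with
  | 0 => 0
  | k.+1 =>
    match k with
    | 0 => 1
    | j.+1 => (a k)^-1 *: (('X - (b j)%:P) * orthopoly_shift a b k
                           - a j *: orthopoly_shift a b j)
    end
  end.

(* Only the indices k >= -1 are meaningful; the value 0 at k < -1 is junk. *)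
Definition orthopoly a b (k : int) : {poly R} :=
  match k with
  | Posz n => orthopoly_shift a b n.+1
  | Negz _ => 0
  end.

Lemma orthopolyN1 a b : orthopoly a b (-1) = 0.
Proof. by []. Qed.

Lemma orthopoly0 a b : orthopoly a b 0 = 1.
Proof. by []. Qed.

Lemma orthopoly_rec a b (k : nat) : (0 < k)%N -> 0 < a k ->
  a k *: orthopoly a b k%:Z
  = ('X - (b k.-1)%:P) * orthopoly a b (k%:Z - 1)
    - a k.-1 *: orthopoly a b (k%:Z - 2).
Proof.
case: k => [|[|k]] // _ ak_gt0.
  by rewrite /= scalerA divff ?gt_eqF // scale1r.
have -> : k.+2%:Z - 1 = k.+1%:Z by rewrite subzn.
have -> : k.+2%:Z - 2 = k%:Z by rewrite subzn // subSS subSS subn0.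
by rewrite [LHS]scalerA divff ?gt_eqF // scale1r.
Qed.

Definition S2 a b (k : nat) : {poly R} :=
  orthopoly a b k%:Z ^+ 2
  - (a k.+1 / a k) *: (orthopoly a b (k%:Z - 1) * orthopoly a b (k%:Z + 1)).

(* The quotient a_1 / a_0 = a_1 / 0 is harmless at k = 0, as p_{-1} = 0. *)
Lemma S2_0 a b : S2 a b 0 = 1.
Proof. by rewrite /S2 /= mul0r scaler0 subr0 expr1n. Qed.

End OrthonormalPolynomials.

(* Main.v *)
Require Import Defs.
From mathcomp Require Import all_boot all_order all_algebra.
From mathcomp Require Import reals.
From mathcomp Require Import ring lra.

(** Fix [x], put [c_k = x - b_k], and eliminate [p_{k+1}] from [S_2(p_k)] with
    the recurrence.  For [k >= 1] this gives
      [a_k S_2(p_k) = a_k (p_k^2 + p_{k-1}^2) - c_k p_k p_{k-1}],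
    a quadratic form in [(p_k, p_{k-1})] (lemma [scaled_S2]).

    If [-2 a_k <= c_k <= 2 a_k], the form is positive semidefinite and the
    claim does not depend on the recurrence ([turan_form_ge0]).

    If [c_k > 2 a_k], monotonicity of [a] and [b] gives
    [c_j >= c_k > 2 a_k >= a_j + a_{j+1}] for every [j < k].  Then the values [p_{-1}(x), p_0(x), ...,
    p_k(x)] are nonnegative and nondecreasing ([recurrence_ge0_ndecr]).  With
    constant coefficients, [a_k] times the form would be a conserved quantity of
    the recurrence; with varying coefficients its increment is
      [(b_{k+1} - b_k) a_{k+1} p_{k+1} p_k + (a_{k+1}^2 - a_k^2) p_k^2],
    which is nonnegative once the values are ([turan_form_step]).  As [a_0 = 0],
    this quantity starts from [0], hence stays nonnegative. *)

Import Order.TTheory GRing.Theory Num.Theory.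

Local Open Scope ring_scope.

Definition turan_form {F : realFieldType} (a c v z : F) : F :=
  a * (v ^+ 2 + z ^+ 2) - c * v * z.

(** The discriminant [c^2 - 4 a^2] is nonpositive. *)
Lemma turan_form_ge0 (F : realFieldType) (a c v z : F) :
  0 < a -> - (2 * a) <= c -> c <= 2 * a -> 0 <= turan_form a c v z.
Proof.
move=> a_gt0 c_ge c_le; rewrite -(pmulr_rge0 _ a_gt0).
(* Completing the square in v. *)
have -> : a * turan_form a c v z =
    (a * v - c * z / 2) ^+ 2 + (2 * a - c) * (2 * a + c) * z ^+ 2 / 4.
  by rewrite /turan_form; field.
by rewrite addr_ge0 ?divr_ge0 ?(sqr_ge0, mulr_ge0) //; lra.
Qed.

(** By the recurrence [a' w = c v - a z], the numbers [a' w] and [a z] sum to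
    [c v].  Hence [a] times the form at [(v, z)] is [a^2 v^2 - (a z) (a' w)],
    which is symmetric in [a' w] and [a z]; only the changes from [a] to [a'] and
    from [c] to [c'] contribute to the increment. *)
Lemma turan_form_step (F : realFieldType) (a a' c c' w v z : F) :
  a' * w = c * v - a * z ->
  0 <= a -> a <= a' -> c' <= c -> 0 <= v -> 0 <= w ->
  a * turan_form a c v z <= a' * turan_form a' c' w v.
Proof.
move=> rec a_ge0 aa' c'c v_ge0 w_ge0; rewrite -subr_ge0.
have -> : a' * turan_form a' c' w v - a * turan_form a c v z =
    (c - c') * (a' * w * v) + (a' - a) * (a' + a) * v ^+ 2.
  have az : a * z = c * v - a' * w by rewrite rec; ring.
  have -> : a * turan_form a c v z =
      a ^+ 2 * v ^+ 2 - c * v * (a * z) + (a * z) ^+ 2.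
    by rewrite /turan_form; ring.
  by rewrite az /turan_form; ring.
have a'_ge0 : 0 <= a' by exact: le_trans aa'.
by rewrite addr_ge0 ?(sqr_ge0, mulr_ge0) ?subr_ge0 ?addr_ge0.
Qed.

(** If [0 <= P_k <= P_{k+1}], then
    [a_{k+1} P_{k+2} >= (c_k - a_k) P_{k+1} >= a_{k+1} P_{k+1}]. *)
Lemma recurrence_ge0_ndecr (F : realFieldType) (a c P : nat -> F) (n : nat) :
  P 0%N = 0 -> P 1%N = 1 ->
  (forall k, a k.+1 * P k.+2 = c k * P k.+1 - a k * P k) ->
  (forall k, 0 <= a k) -> (forall k, 0 < a k.+1) ->
  (forall k, (k < n)%N -> a k + a k.+1 <= c k) ->
  forall k, (k <= n)%N -> 0 <= P k <= P k.+1.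
Proof.
move=> P0 P1 rec a_ge0 a_gt0 c_ge; elim=> [|k IHk] lt_kn.
  by rewrite P0 P1 lexx ler01.
have /andP[Pk_ge0 PkS] := IHk (ltnW lt_kn).
have PS_ge0 : 0 <= P k.+1 by exact: le_trans PkS.
rewrite PS_ge0 /= -(ler_pM2l (a_gt0 k)) rec.
have low : (a k + a k.+1) * P k.+1 <= c k * P k.+1 by rewrite ler_wpM2r ?c_ge.
have : a k * P k <= a k * P k.+1 by rewrite ler_wpM2l.
lra.
Qed.

Lemma turan_form_recurrence_ge0
    (F : realFieldType) (a c P : nat -> F) (n : nat) :
  a 0%N = 0 -> (forall k, 0 < a k.+1) ->
  {homo a : k l / (k <= l)%N >-> k <= l} ->
  {homo c : k l / (k <= l)%N >-> l <= k} ->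
  P 0%N = 0 -> P 1%N = 1 ->
  (forall k, a k.+1 * P k.+2 = c k * P k.+1 - a k * P k) ->
  2 * a n <= c n ->
  0 <= a n * turan_form (a n) (c n) (P n.+1) (P n).
Proof.
move=> a0 a_gt0 a_ndecr c_nincr P0 P1 rec c_ge.
have a_ge0 k : 0 <= a k by case: k => [|k]; rewrite ?a0 // ltW.
have P_ge0_ndecr : forall k, (k <= n)%N -> 0 <= P k <= P k.+1.
  apply: (@recurrence_ge0_ndecr _ a c) => // k lt_kn.
  have := a_ndecr _ _ (ltnW lt_kn); have := a_ndecr _ _ lt_kn.
  have := c_nincr _ _ (ltnW lt_kn); lra.
suff: forall k, (k <= n)%N ->
    0 <= a k * turan_form (a k) (c k) (P k.+1) (P k) by apply.
elim=> [|k IHk] lt_kn; first by rewrite a0 mul0r.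
apply: le_trans (IHk (ltnW lt_kn)) _.
have /andP[PS_ge0 PSS] := P_ge0_ndecr _ lt_kn.
apply: turan_form_step => //; first exact: a_ndecr.
  exact: c_nincr.
exact: le_trans PSS.
Qed.

Lemma horner_orthopoly_shift_rec (R : realType) (a b : nat -> R) (x : R) k :
  a k.+1 != 0 ->
  a k.+1 * (orthopoly_shift a b k.+2).[x] =
    (x - b k) * (orthopoly_shift a b k.+1).[x]
    - a k * (orthopoly_shift a b k).[x].
Proof.
move=> aS_neq0; rewrite [orthopoly_shift a b k.+2]/= hornerZ mulVKf //.
by rewrite !(hornerE, hornerM, hornerZ).
Qed.

Lemma scaled_S2 (R : realType) (a b : nat -> R) (x : R) k :
  a k.+1 != 0 -> a k.+2 != 0 ->
  a k.+1 * (S2 a b k.+1).[x] =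
    turan_form (a k.+1) (x - b k.+1)
      (orthopoly_shift a b k.+2).[x] (orthopoly_shift a b k.+1).[x].
Proof.
move=> aS_neq0 aSS_neq0; rewrite /S2.
have -> : k.+1%:Z - 1 = k%:Z by rewrite subzn // subn1.
have -> : k.+1%:Z + 1 = k.+2%:Z by rewrite -PoszD addn1.
rewrite /orthopoly hornerD hornerN hornerZ horner_exp hornerM.
have := @horner_orthopoly_shift_rec R a b x _ aSS_neq0.
move: (orthopoly_shift a b k.+3).[x] (orthopoly_shift a b k.+2).[x]
  (orthopoly_shift a b k.+1).[x] => w v z rec.
transitivity (a k.+1 * v ^+ 2 - z * (a k.+2 * w)); first by field.
by rewrite rec /turan_form; ring.
Qed.

Theorem theorem8 (R : realType) (a b : nat -> R)
  (a_0 : a 0%N = 0)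
  (a_gt0 : forall k : nat, (1 <= k)%N -> 0 < a k)
  (a_nondecreasing : {homo a : m n / (m <= n)%N >-> m <= n})
  (b_nondecreasing : {homo b : m n / (m <= n)%N >-> m <= n})
  (k : nat) (x : R) (x_ge : b k - 2 * a k <= x) :
  0 <= (S2 a b k).[x].
Proof.
case: k x_ge => [|k] x_ge; first by rewrite S2_0 hornerC ler01.
have aS_gt0 j : 0 < a j.+1 by exact: a_gt0.
have aS_neq0 j : a j.+1 != 0 by rewrite gt_eqF.
rewrite -(pmulr_rge0 _ (aS_gt0 k)) scaled_S2 //.
have [c_le|c_gt] := leP (x - b k.+1) (2 * a k.+1).
  by apply: turan_form_ge0 => //; lra.
rewrite -(pmulr_rge0 _ (aS_gt0 k)).
apply: (@turan_form_recurrence_ge0 _ a (fun j => x - b j)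
  (fun j => (orthopoly_shift a b j).[x])) => //=.
- by move=> i j le_ij; rewrite lerB ?b_nondecreasing.
- by rewrite horner0.
- by rewrite hornerC.
- by move=> j; exact: horner_orthopoly_shift_rec.
- exact: ltW.
Qed.
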